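(* Consider the finite-sum problem $\min_{\omega\in\mathbb{R}^d}F(\omega)$ and the SODDA algorithm described in the context. Suppose: (2) $F$ is strongly convex with parameter $\xi>0$; (3) there is $L\ge 1$ such that $\|\nabla f_i(x_i\omega)-\nabla f_i(x_i\hat\omega)\|\le L\|\omega-\hat\omega\|$ for all $\omega,\hat\omega\in\mathbb{R}^d$ and all $i$; (4) there is a constant $G$ such that $\frac{1}{N-1}\sum_{j=1}^N\left(\|\nabla f_j(x_j\omega^t)\|^2-\|\nabla F(\omega^t)\|^2\right)\le G^2$ for all iterates $\omega^t$; (5) there is a constant $M_2$ such that $\|\omega^t\|\le\frac{M_2}{2}$ for all $t$, and also $\|\omega^*\|\le\frac{M_2}2$. Suppose $\gamma_t=\frac1t$ for $t=1,2,\dots$, $B\ge\frac{d}{2\xi}$, and for some constant $\eta\ge0$ and all $t\ge0$ $$b_t\in\left[\max\left\{c_t,\ \frac{d}{1+\frac{4d\eta\gamma_{t+1}^2}{c_tM_2^2L^2}}\right\},\ d\right],\qquad c_t\le d,\qquad s_t\le N.$$ Then there exists a positive constant $C_3$ such that for all $t\ge0$ $$\mathbb{E}\left[F(\omega^t)-F(\omega^* )\right]\le\frac{R}{1+t},$$ where, with $\lambda=\frac{2\xi B}{d}$ and $[\lambda]$ its integer part, $$R=\max\left\{F(\omega^0)-F(\omega^* ),\ 2\,\mathbb{E}[F(\omega^1)-F(\omega^* )],\ \dots,\ ([\lambda]+2)\,\mathbb{E}\left[F(\omega^{[\lambda]+1})-F(\omega^* )\right],\ \frac{C_3}{\lambda-1}\right\}$$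 (with $\frac{C_3}{\lambda-1}$ read as $+\infty$ if $\lambda=1$).
   Context: Problem. $N,d,P,Q$ are positive integers with $P\mid N$ and $QP\mid d$; put $n=N/P$, $\tilde m=d/(QP)$. Data: row vectors $x_i$ with $x_i^T\in\mathbb{R}^d$, and differentiable functions $f_i:\mathbb{R}\to\mathbb{R}$ ($f_i=\bar f(\cdot,y_i)$ for a loss $\bar f$ and label $y_i$), $i=1,\dots,N$. $F(\omega)=\frac1N\sum_{i=1}^N f_i(x_i\omega)$. $\nabla f_i(x_i\omega)\in\mathbb{R}^d$ denotes the gradient with respect to $\omega$ of $\omega\mapsto f_i(x_i\omega)$. Norms are Euclidean. It is assumed throughout that $F$ has a unique minimizer $\omega^*$. Partitioning. The $N$ observations are split into $P$ partitions of $n$ observations each; the $d$ features are split into $Q$ blocks, each further split into $P$ sub-blocks of size $\tilde m$. Accordingly $\omega=(\omega_{1,1},\dots,\omega_{1,P},\omega_{2,1},\dots,\omega_{Q,P})$ with $\omega_{q,k}\in\mathbb{R}^{\tilde m}$. For $p,k\in\{1,\dots,P\}$, $q\in\{1,\dots,Q\}$, $j\in\{1,\dots,n\}$, $x_j^{p,q,k}$ is the restriction of the $j$-th observation of observation partition $p$ to feature sub-block $(q,k)$, and $f_j^p$ is the function $f_i$ of that observation. $\nabla_{\omega_{q,k}}f_j^p(x_j^{p,q,k}\omega_{q,k})\in\mathbb{R}^{\tilde m}$ is the gradient of $\omega_{q,k}\mapsto f_j^p(x_j^{p,q,k}\omega_{q,k})$ (only the local sub-block enters the inner product). SODDA. Inputs: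 integer $B\ge1$ (batch size), positive learning rates $(\gamma_t)_{t\ge1}$, integers $1\le c_t\le b_t\le d$, $1\le s_t\le N$ for $t\ge0$. Start with $\omega^0=0$. For $t=0,1,2,\dots$: - sample $\mathcal B_t\subseteq\{1,\dots,d\}$ of size $b_t$ uniformly without replacement; sample $\mathcal C_t\subseteq\mathcal B_t$ of size $c_t$ uniformly without replacement; sample $\mathcal D_t\subseteq\{1,\dots,N\}$ of size $s_t$ uniformly without replacement; - let $\mu^t=\frac1{s_t}\sum_{j\in\mathcal D_t}g_j$, where $g_j\in\mathbb{R}^d$ has $k$-th coordinate $f_j'\big(\sum_{l\in\mathcal B_t}(x_j)_l\,\omega^t_l\big)(x_j)_k$ if $k\in\mathcal C_t$ and $0$ otherwise; - for each $q$, select a (random) bijection $\pi_q$ of $\{1,\dots,P\}$; - for all $p,q$ in parallel, with $k=\pi_q(p)$: set $\bar\omega^{(0)}_{q,k}=\omega^t_{q,k}$, and for $i=0,\dots,B-1$ pick $j\in\{1,\dots,n\}$ uniformly at random (freshly for each $p,q,i$) and set $$\bar\omega^{(i+1)}_{q,k}=\bar\omega^{(i)}_{q,k}-\gamma_{t+1}\Big[\nabla_{\omega_{q,k}}f_j^p(x_j^{p,q,k}\bar\omega^{(i)}_{q,k})-\nabla_{\omega_{q,k}}f_j^p(x_j^{p,q,k}\omega^t_{q,k})+\mu^t_{q,k}\Big],$$ where $\mu^t_{q,k}$ is the $(q,k)$ sub-block of $\mu^t$; - $\omega^{t+1}$ is the concatenation of all $\bar\omega^{(B)}_{q,k}$.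 All random choices are made independently of the past and of each other, except that $\mathcal C_t$ is drawn from $\mathcal B_t$. *)

(* Defs.v *)
From HB Require Import structures.
From mathcomp Require Export all_boot all_order all_fingroup all_algebra.
From mathcomp Require Export all_classical all_reals all_analysis.

Set Implicit Arguments.
Unset Strict Implicit.
Unset Printing Implicit Defensive.
Import Order.TTheory GRing.Theory Num.Theory.
Export numFieldNormedType.Exports.

Local Open Scope classical_set_scope.
Local Open Scope ring_scope.

(* The library norm on matrices is the maximum norm, so the Euclidean one is
   introduced separately. *)
Definition enorm (R : realType) (m : nat) (v : 'cV[R]_m) : R :=
  Num.sqrt (\sum_(k < m) v k 0 ^+ 2).

Definition grad (R : realType) (m : nat) (g : 'cV[R]_m -> R) (w : 'cV[R]_m) :
    'cV[R]_m :=
  \col_(k < m) 'D_(delta_mx k 0) g w.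

Definition strongly_convex (R : realType) (m : nat) (xi : R)
    (g : 'cV[R]_m -> R) : Prop :=
  forall (v w : 'cV[R]_m) (a : R), 0 <= a <= 1 ->
    g (a *: v + (1 - a) *: w) <=
      a * g v + (1 - a) * g w - xi / 2 * a * (1 - a) * enorm (v - w) ^+ 2.

Definition unique_minimizer (R : realType) (m : nat) (g : 'cV[R]_m -> R)
    (w : 'cV[R]_m) : Prop :=
  (forall v, g w <= g v) /\ (forall v, (forall u, g v <= g u) -> v = w).

Definition lin_comp (R : realType) (m : nat) (x : 'rV[R]_m) (h : R -> R)
    (w : 'cV[R]_m) : R :=
  h ((x *m w) 0 0).

Definition objective (R : realType) (N d : nat) (x : 'I_N -> 'rV[R]_d)
    (f : 'I_N -> R -> R) (w : 'cV[R]_d) : R :=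
  N%:R^-1 * \sum_(i < N) lin_comp (x i) (f i) w.

(* [obs (p, j)] is the j-th observation of observation partition p;
   [coord (q, k, l)] is the l-th coordinate of feature sub-block (q, k), and
   [addr] is the inverse of [coord]. *)
Record splitting (N d P Q : nat) := Splitting {
  obs : 'I_P * 'I_(N %/ P) -> 'I_N;
  obs_bij : bijective obs;
  coord : 'I_Q * 'I_P * 'I_(d %/ (Q * P)) -> 'I_d;
  addr : 'I_d -> 'I_Q * 'I_P * 'I_(d %/ (Q * P));
  coordK : cancel coord addr;
  addrK : cancel addr coord }.

Definition sub_row (R : realType) (N d P Q : nat) (sp : splitting N d P Q)
    (q : 'I_Q) (k : 'I_P) (v : 'rV[R]_d) : 'rV[R]_(d %/ (Q * P)) :=
  \row_l v 0 (coord sp (q, k, l)).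

Definition sub_col (R : realType) (N d P Q : nat) (sp : splitting N d P Q)
    (q : 'I_Q) (k : 'I_P) (v : 'cV[R]_d) : 'cV[R]_(d %/ (Q * P)) :=
  \col_l v (coord sp (q, k, l)) 0.

(* The random choices of the whole run, as functions of the sample point; the
   first argument is the iteration. *)
Record sampling (T : Type) (N d P Q B : nat) := Sampling {
  drawB : nat -> T -> {set 'I_d};
  drawC : nat -> T -> {set 'I_d};
  drawD : nat -> T -> {set 'I_N};
  drawPi : nat -> 'I_Q -> T -> {perm 'I_P};
  drawJ : nat -> 'I_P -> 'I_Q -> 'I_B -> T -> 'I_(N %/ P) }.

Definition sodda_mu (R : realType) (N d : nat) (x : 'I_N -> 'rV[R]_d)
    (f : 'I_N -> R -> R) (s : nat) (Bt Ct : {set 'I_d}) (Dt : {set 'I_N})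
    (w : 'cV[R]_d) : 'cV[R]_d :=
  s%:R^-1 *: \sum_(j in Dt)
    \col_(k < d) (if k \in Ct
                  then derive1 (f j) (\sum_(l in Bt) x j 0 l * w l 0) * x j 0 k
                  else 0).

(* One inner update of the sub-block (q, k) by processor p, with learning rate
   [g], sampled local observation [j] and current inner value [v]. *)
Definition inner_step (R : realType) (N d P Q : nat) (sp : splitting N d P Q)
    (x : 'I_N -> 'rV[R]_d) (f : 'I_N -> R -> R) (g : R) (mu w : 'cV[R]_d)
    (p : 'I_P) (q : 'I_Q) (k : 'I_P) (j : 'I_(N %/ P))
    (v : 'cV[R]_(d %/ (Q * P))) : 'cV[R]_(d %/ (Q * P)) :=
  let phi := lin_comp (sub_row sp q k (x (obs sp (p, j)))) (f (obs sp (p, j))) in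
  v - g *: (grad phi v - grad phi (sub_col sp q k w) + sub_col sp q k mu).

Definition inner_loop (R : realType) (N d P Q B : nat) (sp : splitting N d P Q)
    (x : 'I_N -> 'rV[R]_d) (f : 'I_N -> R -> R) (g : R) (mu w : 'cV[R]_d)
    (p : 'I_P) (q : 'I_Q) (k : 'I_P) (J : 'I_B -> 'I_(N %/ P)) :
    'cV[R]_(d %/ (Q * P)) :=
  foldl (fun v i => inner_step sp x f g mu w p q k (J i) v)
    (sub_col sp q k w) (enum 'I_B).

(* The sub-block (q, k) is handled by the processor p with [pi_ q p = k]. *)
Definition sodda_step (R : realType) (N d P Q B : nat) (sp : splitting N d P Q)
    (x : 'I_N -> 'rV[R]_d) (f : 'I_N -> R -> R) (g : R) (mu w : 'cV[R]_d)
    (pi_ : 'I_Q -> {perm 'I_P}) (J : 'I_P -> 'I_Q -> 'I_B -> 'I_(N %/ P)) :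
    'cV[R]_d :=
  \col_(r < d)
    let: (q, k, l) := addr sp r in
    let p := ((pi_ q)^-1)%g k in
    inner_loop sp x f g mu w p q k (J p q) l 0.

Fixpoint sodda (R : realType) (T : Type) (N d P Q B : nat)
    (sp : splitting N d P Q) (x : 'I_N -> 'rV[R]_d) (f : 'I_N -> R -> R)
    (gamma : nat -> R) (s : nat -> nat) (smp : sampling T N d P Q B)
    (t : nat) (z : T) : 'cV[R]_d :=
  if t is t'.+1 then
    let w := sodda sp x f gamma s smp t' z in
    let mu := sodda_mu x f (s t')
                (drawB smp t' z) (drawC smp t' z) (drawD smp t' z) w in
    sodda_step sp x f (gamma t) mu w
      (fun q => drawPi smp t' q z) (fun p q i => drawJ smp t' p q i z)
  else 0.

(* A finite subfamily of the index type is listed by an injection [h]. *)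
Definition mutually_independent (dsp : measure_display)
    (T : measurableType dsp) (R : realType) (Pr : probability T R) (I : Type)
    (E : I -> set (set T)) : Prop :=
  forall (m : nat) (h : 'I_m -> I), injective h ->
  forall A : 'I_m -> set T, (forall i, E (h i) (A i)) ->
    Pr (\bigcap_(i in [set: 'I_m]) A i) = (\prod_(i < m) Pr (A i))%E.

Definition uniform_on (dsp : measure_display) (T : measurableType dsp)
    (R : realType) (Pr : probability T R) (U : finType) (X : T -> U)
    (A : {set U}) : Prop :=
  forall u : U,
    Pr (X @^-1` [set u]) = (if u \in A then #|A|%:R^-1 else 0)%:E.

Inductive draw_label (P Q B : nat) :=
  | LabelBC of nat
  | LabelD of nat
  | LabelPerm of nat & 'I_Q
  | LabelJ of nat & 'I_P & 'I_Q & 'I_B.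

Definition events_of (T U : Type) (X : T -> U) : set (set T) :=
  preimage_set_system setT X setT.

(* [drawB t] and [drawC t] share a label: they are not independent of each
   other. *)
Definition draw_events (T : Type) (N d P Q B : nat)
    (smp : sampling T N d P Q B) (a : draw_label P Q B) : set (set T) :=
  match a with
  | LabelBC t => events_of (fun z => (drawB smp t z, drawC smp t z))
  | LabelD t => events_of (drawD smp t)
  | LabelPerm t q => events_of (drawPi smp t q)
  | LabelJ t p q i => events_of (drawJ smp t p q i)
  end.

(* The law of each permutation is left arbitrary. *)
Record sodda_sampling (dsp : measure_display) (T : measurableType dsp)
    (R : realType) (Pr : probability T R) (N d P Q B : nat)
    (b c s : nat -> nat) (smp : sampling T N d P Q B) : Prop := SoddaSampling {
  draw_measurable : forall a : draw_label P Q B,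
    draw_events smp a `<=` measurable;
  draw_independent : mutually_independent Pr (draw_events smp);
  drawB_law : forall t,
    uniform_on Pr (drawB smp t) [set S : {set 'I_d} | #|S| == b t]%SET;
  drawC_law : forall t (S U : {set 'I_d}),
    let A := [set V : {set 'I_d} | (V \subset S) && (#|V| == c t)]%SET in
    Pr [set z | drawB smp t z = S /\ drawC smp t z = U] =
      (Pr [set z | drawB smp t z = S] *
       (if U \in A then #|A|%:R^-1 else 0)%:E)%E;
  drawD_law : forall t,
    uniform_on Pr (drawD smp t) [set S : {set 'I_N} | #|S| == s t]%SET;
  drawJ_law : forall t p q i,
    uniform_on Pr (drawJ smp t p q i) [set: 'I_(N %/ P)]%SET }.

(* [C / (lambda - 1)], read as infinite when [lambda = 1]. *)
Definition rate_tail (R : realType) (C lambda : R) : \bar R :=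
  if lambda == 1 then +oo%E else (C / (lambda - 1))%:E.

(* Main.v *)
(* Since C3 may depend on the problem data and on the whole run, only the order
   O(1/t) of the expected gap matters. The lower bound on the integer b_t tends
   to d, so eventually b_t = d and mu^t is unbiased up to the factor c_t/d.
   The iterates stay in a bounded set, on which the B inner steps amount to the
   single step - gamma B mu^t up to O(gamma^2). Smoothness and the
   Polyak-Lojasiewicz inequality |grad F|^2 >= 2 xi (F - min F) then give
     a_{t+1} <= (1 - lambda/(t+1)) a_t + K/(t+1)^2
   for the expected gap a_t, hence a_t = O(1/t) when lambda > 1; when
   lambda = 1 the bound is infinite. All draws are finite-valued, so the
   expectations are finite sums over the histories of draws. *)
From mathcomp Require Import ring lra.
Require Import Defs.
Set Implicit Arguments.
Unset Strict Implicit.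
Unset Printing Implicit Defensive.
Import Order.TTheory GRing.Theory Num.Theory.
Import numFieldNormedType.Exports.
Local Open Scope classical_set_scope.
Local Open Scope ring_scope.

(** * Finite-valued random variables *)

(** Point masses are taken in [R], so that expectations become finite sums of reals; [fine] loses
    nothing because probabilities are finite. *)
Definition pmf (dsp : measure_display) (T : measurableType dsp) (R : realType)
    (Pr : probability T R) (U : Type) (X : T -> U) (u : U) : R :=
  fine (Pr (X @^-1` [set u])).

(** The value type carries no sigma-algebra. For a finite [U] this condition amounts to
    measurability for the discrete one. *)
Definition measurable_fibers (dsp : measure_display) (T : measurableType dsp)
    (U : Type) (X : T -> U) : Prop :=
  forall u, measurable (X @^-1` [set u]).

Lemma pmfE (dsp : measure_display) (T : measurableType dsp) (R : realType)
    (Pr : probability T R) (U : Type) (X : T -> U) (u : U) :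
  measurable_fibers X -> Pr (X @^-1` [set u]) = (pmf Pr X u)%:E.
Proof. by move=> mX; rewrite /pmf fineK// fin_num_measure. Qed.

Lemma pmf_ge0 (dsp : measure_display) (T : measurableType dsp) (R : realType)
    (Pr : probability T R) (U : Type) (X : T -> U) (u : U) :
  0 <= pmf Pr X u.
Proof. exact: fine_ge0. Qed.

(** Since [U] is finite, [g \o X] is a finite linear combination of the indicators of the fibers of
    [X], and the integral is linear. *)
Lemma expectation_pmf (dsp : measure_display) (T : measurableType dsp)
    (R : realType) (Pr : probability T R) (U : finType) (X : T -> U)
    (g : U -> R) : measurable_fibers X ->
  'E_Pr[g \o X]%E = (\sum_u g u * pmf Pr X u)%:E.
Proof.
move=> mX; rewrite unlock.
transitivity (\int[Pr]_z
    (\sum_(u : U) (g u)%:E * (\1_(X @^-1` [set u]) z)%:E))%E.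
  apply: eq_integral => z _ /=; rewrite (bigD1 (X z))//= big1 ?adde0.
    by rewrite indicE mem_set// mule1.
  by move=> u uX; rewrite indicE memNset ?mule0// => /= E; rewrite E eqxx in uX.
have inti u : Pr.-integrable setT (fun z => (\1_(X @^-1` [set u]) z)%:E).
  exact: integrable_indic.
rewrite integral_sum//; last by move=> u; apply: integrableZl.
rewrite -sumEFin; apply: eq_bigr => u _.
by rewrite integralZl// integral_indic// setIT EFinM -(pmfE Pr u mX).
Qed.

Lemma measurable_fibers_pair (dsp : measure_display) (T : measurableType dsp)
    (U V : Type) (X : T -> U) (Y : T -> V) :
  measurable_fibers X -> measurable_fibers Y ->
  measurable_fibers (fun z => (X z, Y z)).
Proof.
move=> mX mY [u v].
have -> : (fun z => (X z, Y z)) @^-1` [set (u, v)] =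
          (X @^-1` [set u]) `&` (Y @^-1` [set v]).
  by apply/seteqP; split=> z /= => [[-> ->]|[-> ->]].
exact: measurableI.
Qed.

Lemma sum_pmf (dsp : measure_display) (T : measurableType dsp)
    (R : realType) (Pr : probability T R) (U : finType) (X : T -> U) :
  measurable_fibers X -> \sum_u pmf Pr X u = 1.
Proof.
move=> mX; have := expectation_pmf Pr (fun=> 1) mX.
have -> : (fun=> 1 : R) \o X = cst 1 by [].
rewrite expectation_cst => -[->].
by apply: eq_bigr => u _; rewrite mul1r.
Qed.

(** A fiber on which [A] fails lies inside a null set, hence has mass zero. *)
Lemma ae_pmf (dsp : measure_display) (T : measurableType dsp) (R : realType)
    (Pr : probability T R) (U : Type) (X : T -> U) (A : U -> Prop) (u : U) :
  measurable_fibers X -> {ae Pr, forall z, A (X z)} ->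
  pmf Pr X u != 0 -> A u.
Proof.
move=> mX aeA; apply: contra_neqP => nAu; rewrite /pmf.
suff -> : Pr (X @^-1` [set u]) = 0%E by [].
apply/(negligibleP _ (mX u)); case: aeA => S [mS S0 sub].
by exists S; split=> // z /= Xz; apply: sub => /=; rewrite Xz.
Qed.

(** Both sums are taken over the joint law of [(X, Y)], where the inequality holds at every value of
    nonzero mass. This compares expectations written over different finite spaces. *)
Lemma ae_le_sum_pmf (dsp : measure_display) (T : measurableType dsp)
    (R : realType) (Pr : probability T R) (U V : finType) (X : T -> U)
    (Y : T -> V) (g : U -> R) (h : V -> R) :
  measurable_fibers X -> measurable_fibers Y ->
  {ae Pr, forall z, g (X z) <= h (Y z)} ->
  \sum_u g u * pmf Pr X u <= \sum_v h v * pmf Pr Y v.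
Proof.
move=> mX mY gh; rewrite -lee_fin -!expectation_pmf//.
have mXY := measurable_fibers_pair mX mY.
have -> : g \o X = (fun uv => g uv.1) \o (fun z => (X z, Y z)) by [].
have -> : h \o Y = (fun uv => h uv.2) \o (fun z => (X z, Y z)) by [].
rewrite !expectation_pmf// lee_fin; apply: ler_sum => uv _.
have [->|pn0] := eqVneq (pmf Pr (fun z => (X z, Y z)) uv) 0; first by rewrite !mulr0.
apply: ler_wpM2r; first exact: pmf_ge0.
exact: (ae_pmf (A := fun uv => g uv.1 <= h uv.2) mXY gh pn0).
Qed.

Lemma mutually_independent_fin (dsp : measure_display) (T : measurableType dsp)
    (R : realType) (Pr : probability T R) (I : Type) (E : I -> set (set T))
    (J : finType) (h : J -> I) (A : J -> set T) :
  mutually_independent Pr E -> injective h -> (forall j, E (h j) (A j)) ->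
  Pr (\bigcap_j A j) = (\prod_j Pr (A j))%E.
Proof.
move=> indep hi EA.
have := indep #|J| (h \o enum_val) (inj_comp hi enum_val_inj) (A \o enum_val)
  (fun i => EA _).
have -> : \bigcap_(i in [set: 'I_#|J|]) (A \o enum_val) i = \bigcap_j A j.
  apply/seteqP; split=> z /= Az j _.
    by have := Az (enum_rank j) Logic.I; rewrite /= enum_rankK.
  exact: Az.
move=> ->; rewrite (reindex_onto (@enum_val J J) enum_rank); last first.
  by move=> j _; rewrite enum_rankK.
by apply: eq_bigl => i; rewrite enum_valK eqxx.
Qed.

(** * Inclusion probabilities of uniform subsets of fixed size *)

Lemma card_draws_mem (T : finType) (c : nat) (k : T) :
  #|[set V : {set T} | (#|V| == c.+1) && (k \in V)]%SET| = 'C(#|T|.-1, c).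
Proof.
have <- : #|[set~ k]%SET| = #|T|.-1 by rewrite cardsC1.
(* Adding [k] maps the [c]-subsets of the complement of [k] bijectively onto the sets being
   counted. *)
rewrite -cards_draws -[RHS](card_in_imset (f := fun A => k |: A)%SET); last first.
  move=> A B; rewrite !inE => /andP[/fintype.subsetP sA _].
  move=> /andP[/fintype.subsetP sB _] AB.
  apply/setP => i; have /setP/(_ i) := AB; rewrite !inE.
  case: eqVneq => //= -> _.
  have nin (C : {set T}) : {subset C <= [set~ k]%SET} -> (k \in C) = false.
    by move=> sC; apply/negP => /sC; rewrite !inE eqxx.
  by rewrite !nin.
congr #|pred_of_set _|; apply/setP => V; rewrite !inE.
apply/andP/imsetP => [[/eqP cV kV]|[A]].
  exists (V :\ k)%SET; last by rewrite finset.setD1K.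
  by rewrite !inE finset.subsetDr/= -eqSS -cV (cardsD1 k V) kV.
rewrite !inE => /andP[/fintype.subsetP sA /eqP <-] ->.
rewrite finset.setU11 cardsU1 (_ : k \notin A)//.
by apply/negP => /sA; rewrite !inE eqxx.
Qed.

Lemma uniform_draw_mem (R : realType) (T : finType) (c : nat) (k : T) :
  (c.+1 <= #|T|)%N ->
  let A := [set V : {set T} | #|V| == c.+1]%SET in
  \sum_(V : {set T} | k \in V) (if V \in A then #|A|%:R^-1 else 0 : R) =
  c.+1%:R / #|T|%:R.
Proof.
move=> cT A; rewrite -big_mkcondr/= sumr_const.
have -> : #|[pred i : {set T} | (k \in i) && (i \in A)]| =
          #|[set V : {set T} | (#|V| == c.+1) && (k \in V)]%SET|.
  by apply: eq_card => V; rewrite !inE andbC.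
rewrite card_draws_mem card_draws.
(* The probability is C(n-1,c) / C(n,c+1), which this identity between neighbouring binomials turns
   into (c+1)/n. *)
have h := mul_bin_diag #|T| c.
have b0 : ('C(#|T|, c.+1)%:R : R) != 0.
  by rewrite pnatr_eq0 -lt0n bin_gt0.
have t0 : (#|T|%:R : R) != 0 by rewrite pnatr_eq0 -lt0n (leq_trans _ cT).
rewrite -[LHS]mulr_natr mulrC; apply/eqP.
by rewrite eqr_div// -!natrM mulnC h.
Qed.

(** * Histories of draws *)

(** [draw_label] ranges over all iterations and is infinite; this finite type codes the labels of
    the iterations below [t]. The nested options and the sum stand for its four constructors, so
    finiteness is inherited. *)
Definition history_label (P Q B t : nat) : finType :=
  ('I_t * option (option ('I_Q + 'I_P * 'I_Q * 'I_B)))%type.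

Definition label_of (P Q B t : nat) (a : history_label P Q B t) :
    draw_label P Q B :=
  match a.2 with
  | None => LabelBC _ _ _ a.1
  | Some None => LabelD _ _ _ a.1
  | Some (Some (inl q)) => LabelPerm _ _ a.1 q
  | Some (Some (inr (p, q, i))) => LabelJ a.1 p q i
  end.

Lemma label_of_inj (P Q B t : nat) : injective (@label_of P Q B t).
Proof.
by move=> [i [[[q|[[p q] j]]|]|]] [i' [[[q'|[[p' q'] j']]|]|]];
  rewrite /label_of//=; case=> E *; rewrite (ord_inj E); subst.
Qed.

(* One common value type for all draws, so that a history is a plain [ffun]. *)
Definition draw_value (N d P : nat) : finType :=
  ({set 'I_d} * {set 'I_d} + {set 'I_N} + {perm 'I_P} + 'I_(N %/ P))%type.

Definition draw_at (T : Type) (N d P Q B : nat) (smp : sampling T N d P Q B)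
    (a : draw_label P Q B) (z : T) : draw_value N d P :=
  match a with
  | LabelBC t => inl (inl (inl (drawB smp t z, drawC smp t z)))
  | LabelD t => inl (inl (inr (drawD smp t z)))
  | LabelPerm t q => inl (inr (drawPi smp t q z))
  | LabelJ t p q i => inr (drawJ smp t p q i z)
  end.

Definition history (T : Type) (N d P Q B : nat) (smp : sampling T N d P Q B)
    (t : nat) (z : T) : {ffun history_label P Q B t -> draw_value N d P} :=
  [ffun a => draw_at smp (label_of a) z].

Lemma events_of_preimage (T U : Type) (X : T -> U) (Y : set U) :
  events_of X (X @^-1` Y).
Proof. by exists Y => //; rewrite setTI. Qed.

Lemma draw_at_events (T : Type) (N d P Q B : nat) (smp : sampling T N d P Q B)
    (a : draw_label P Q B) (v : draw_value N d P) :
  draw_events smp a (draw_at smp a @^-1` [set v]).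
Proof.
case: a => [t|t|t q|t p q i] /=.
- exact: (@events_of_preimage _ _ (fun z => (drawB smp t z, drawC smp t z))
    [set u | inl (inl (inl u)) = v]).
- exact: (@events_of_preimage _ _ (drawD smp t) [set u | inl (inl (inr u)) = v]).
- exact: (@events_of_preimage _ _ (drawPi smp t q) [set u | inl (inr u) = v]).
- exact: (@events_of_preimage _ _ (drawJ smp t p q i) [set u | inr u = v]).
Qed.

Lemma history_fiber (T : Type) (N d P Q B : nat) (smp : sampling T N d P Q B)
    (t : nat) (u : {ffun history_label P Q B t -> draw_value N d P}) :
  history smp t @^-1` [set u] =
  \bigcap_a (draw_at smp (label_of a) @^-1` [set u a]).
Proof.
apply/seteqP; split=> [z /= <- a _|z /= H]; first by rewrite /= ffunE.
by apply/ffunP => a; rewrite ffunE; exact: H.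
Qed.

Lemma history_draw (T : Type) (N d P Q B : nat) (smp : sampling T N d P Q B)
    (t r : nat) (z z' : T) (o : option (option ('I_Q + 'I_P * 'I_Q * 'I_B)))
    (rt : (r < t)%N) : history smp t z = history smp t z' ->
  draw_at smp (label_of (Ordinal rt, o)) z =
  draw_at smp (label_of (Ordinal rt, o)) z'.
Proof. by move/ffunP/(_ (Ordinal rt, o)); rewrite !ffunE. Qed.

Lemma historyS (T : Type) (N d P Q B : nat) (smp : sampling T N d P Q B)
    (t : nat) (z z' : T) : history smp t.+1 z = history smp t.+1 z' ->
  history smp t z = history smp t z'.
Proof.
move=> H; apply/ffunP => -[[r rt] o]; rewrite !ffunE.
exact: (history_draw o (ltnW rt : (r < t.+1)%N) H).
Qed.

(** By induction: the passage from iterate [t] to [t.+1] reads only the draws labelled [t], and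
    these are components of the history of length [t.+1]. *)
Lemma sodda_history (R : realType) (T : Type) (N d P Q B : nat)
    (sp : splitting N d P Q) (x : 'I_N -> 'rV[R]_d) (f : 'I_N -> R -> R)
    (gamma : nat -> R) (s : nat -> nat) (smp : sampling T N d P Q B)
    (t : nat) (z z' : T) : history smp t z = history smp t z' ->
  sodda sp x f gamma s smp t z = sodda sp x f gamma s smp t z'.
Proof.
elim: t => [|t IH] H; first reflexivity.
have HD o := history_draw o (ltnSn t) H.
have [eB eC] : drawB smp t z = drawB smp t z' /\ drawC smp t z = drawC smp t z'.
  by have [] := HD None.
have eD : drawD smp t z = drawD smp t z' by have [] := HD (Some None).
have eP : (fun q => drawPi smp t q z) = (fun q => drawPi smp t q z').
  by apply: funext => q; have [] := HD (Some (Some (inl q))).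
have eJ : (fun p q i => drawJ smp t p q i z) =
          (fun p q i => drawJ smp t p q i z').
  apply: funext => p; apply: funext => q; apply: funext => i.
  by have [] := HD (Some (Some (inr (p, q, i)))).
by rewrite /= (IH (historyS H)) eB eC eD eP eJ.
Qed.

(** This brings a quantity determined by the history into the form [g \o history smp t], to which
    [expectation_pmf] applies. The factor [g] comes from choice, with the default [r0] at histories
    that never occur. *)
Lemma fun_history (T : Type) (R : Type) (r0 : R) (N d P Q B : nat)
    (smp : sampling T N d P Q B) (t : nat) (Y : T -> R) :
  (forall z z', history smp t z = history smp t z' -> Y z = Y z') ->
  exists g, Y = g \o history smp t.
Proof.
move=> HY.
have /boolp.choice[g Hg] : forall u, exists r, forall z,
    history smp t z = u -> Y z = r.
  move=> u; have [[z0 <-]|nz] := pselect (exists z, history smp t z = u).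
    by exists (Y z0) => z /HY.
  by exists r0 => z Hz; case: nz; exists z.
by exists g; apply: funext => z /=; exact: Hg.
Qed.

(** * Joint law of a history and the draws that follow it *)

Section Law.
Context (dsp : measure_display) (T : measurableType dsp) (R : realType).
Context (Pr : probability T R) (N d P Q B : nat) (b c s : nat -> nat).
Context (smp : sampling T N d P Q B) (hsmp : sodda_sampling Pr b c s smp).

Let BC (t : nat) (z : T) := (drawB smp t z, drawC smp t z).

Lemma measurable_history (t : nat) : measurable_fibers (history smp t).
Proof.
move=> u; rewrite history_fiber; apply: fin_bigcap_measurable => [|a _].
  exact: finite_finset.
apply: (draw_measurable hsmp); exact: draw_at_events.
Qed.

Lemma measurable_drawBC (t : nat) : measurable_fibers (BC t).
Proof.
move=> u; apply: (draw_measurable hsmp (a := LabelBC _ _ _ t)).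
exact: events_of_preimage.
Qed.

Lemma measurable_drawD (t : nat) : measurable_fibers (drawD smp t).
Proof.
move=> u; apply: (draw_measurable hsmp (a := LabelD _ _ _ t)).
exact: events_of_preimage.
Qed.

(** The labels in the history have iteration below [t], so they differ from the two labels of
    iteration [t]. Independence is applied twice: to all these labels together, then to those of the
    history alone to reassemble its mass. *)
Lemma pmf_history (t : nat) u bc D :
  pmf Pr (fun z => (history smp t z, BC t z, drawD smp t z)) (u, bc, D) =
  pmf Pr (history smp t) u * pmf Pr (BC t) bc * pmf Pr (drawD smp t) D.
Proof.
apply: EFin_inj; rewrite !EFinM -!pmfE//; [|exact: measurable_drawD
  |exact: measurable_drawBC|exact: measurable_history|]; last first.
  do 2?apply: measurable_fibers_pair; [exact: measurable_history
    |exact: measurable_drawBC|exact: measurable_drawD].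
(* The boolean adds the two fresh labels: [true] for the pair of feature sets, [false] for the
   observation set. *)
pose h (j : history_label P Q B t + bool) : draw_label P Q B :=
  match j with
  | inl a => label_of a
  | inr i => if i then LabelBC P Q B t else LabelD P Q B t
  end.
pose A (j : history_label P Q B t + bool) : set T :=
  match j with
  | inl a => draw_at smp (label_of a) @^-1` [set u a]
  | inr i => if i then BC t @^-1` [set bc] else drawD smp t @^-1` [set D]
  end.
have hinj : injective h.
  have aux (a : history_label P Q B t) i : label_of a <> h (inr i).
    case: a => [[r rt] [[[q|[[p q] j]]|]|]]; case: i; rewrite /label_of//=;
    by case=> E; have := ltn_eqF rt; rewrite E eqxx.
  move=> [a|i] [a'|i'] //=; first by move/label_of_inj ->.
  - by move/aux.
  - by move/esym/aux.
  - by case: i; case: i'.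
have hA j : draw_events smp (h j) (A j).
  case: j => [a|[]] /=; first exact: draw_at_events.
  - exact: events_of_preimage.
  - exact: events_of_preimage.
transitivity (Pr (\bigcap_j A j)).
  congr (Pr _); apply/seteqP; split=> [z /= [eu eBC eD] [a|[]] _ //=|z Az /=].
    by rewrite -eu ffunE.
  have -> : BC t z = bc by exact: (Az (inr true)).
  have -> : drawD smp t z = D by exact: (Az (inr false)).
  congr (_, _, _); have : (history smp t @^-1` [set u]) z; last by [].
  by rewrite history_fiber => a _; exact: (Az (inl a)).
rewrite (mutually_independent_fin (draw_independent hsmp) hinj hA).
rewrite big_sumType/= big_bool/= muleA; congr (_ * _ * _)%E.
rewrite history_fiber; apply/esym.
apply: (mutually_independent_fin (draw_independent hsmp) (@label_of_inj P Q B t)).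
by move=> a; exact: draw_at_events.
Qed.

End Law.

(** * Smoothness and strong convexity *)

Lemma enorm_sqr (R : realType) (m : nat) (v : 'cV[R]_m) :
  enorm v ^+ 2 = \sum_(k < m) v k 0 ^+ 2.
Proof. by rewrite /enorm sqr_sqrtr// sumr_ge0// => k _; exact: sqr_ge0. Qed.

Lemma enormZ (R : realType) (m : nat) (a : R) (v : 'cV[R]_m) :
  enorm (a *: v) = `|a| * enorm v.
Proof.
rewrite /enorm -sqrtr_sqr -sqrtrM ?sqr_ge0//; congr (Num.sqrt _).
by rewrite mulr_sumr; apply: eq_bigr => k _; rewrite mxE exprMn.
Qed.

Lemma coord_le_enorm (R : realType) (m : nat) (v : 'cV[R]_m) (k : 'I_m) :
  `|v k 0| <= enorm v.
Proof.
rewrite -ler_sqr ?nnegrE ?sqrtr_ge0//; rewrite enorm_sqr (bigD1 k)//=.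
by rewrite real_normK ?num_real// lerDl sumr_ge0// => i _; exact: sqr_ge0.
Qed.

Lemma ler_term_sum (R : realType) (I : finType) (F : I -> R) (i : I) :
  (forall j, 0 <= F j) -> F i <= \sum_j F j.
Proof. by move=> F0; rewrite (bigD1 i)//= lerDl sumr_ge0. Qed.

Lemma sum_sqr_lin (R : realType) (I : finType) (a b : R) (F G : I -> R) :
  \sum_k (a * F k + b * G k) ^+ 2 =
  a ^+ 2 * \sum_k F k ^+ 2 + 2 * a * b * \sum_k F k * G k
  + b ^+ 2 * \sum_k G k ^+ 2.
Proof. by rewrite !mulr_sumr -!big_split/=; apply: eq_bigr => k _; ring. Qed.

Lemma sum_sqr_eq0 (R : realType) (I : finType) (F : I -> R) (k : I) :
  \sum_i F i ^+ 2 = 0 -> F k = 0.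
Proof.
move=> F0; have /eqP := psumr_eq0P (fun i _ => sqr_ge0 (F i)) F0 (i := k) isT.
by rewrite sqrf_eq0 => /eqP.
Qed.

Lemma derive_line (R : realType) (m : nat) (g : 'cV[R]_m -> R)
    (v w : 'cV[R]_m) :
  'D_v g w = derive1 (fun t => g (t *: v + w)) 0.
Proof.
rewrite /derive /derive1 scale0r add0r.
suff -> : (fun h : R => h^-1 *: ((g \o shift w) (h *: v) - g w)) =
          (fun h : R => h^-1 *: (g ((h + 0) *: v + w) - g w)) by [].
by apply: funext => h; rewrite /= addr0.
Qed.

Lemma grad_lin_comp (R : realType) (m : nat) (x : 'rV[R]_m) (h : R -> R)
    (w : 'cV[R]_m) : (forall u, derivable h u 1) ->
  grad (lin_comp x h) w = \col_k (derive1 h ((x *m w) 0 0) * x 0 k).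
Proof.
move=> dh; apply/colP => k; rewrite mxE [RHS]mxE derive_line.
have -> : (fun t => lin_comp x h (t *: delta_mx k 0 + w)) =
          h \o (fun t : R => t * x 0 k + (x *m w) 0 0).
  apply: funext => t; rewrite /lin_comp/= mulmxDr -scalemxAr !mxE.
  congr (h (_ * _ + _)).
  rewrite (bigD1 k)//= big1 ?addr0 => [|i ik]; rewrite !mxE ?eqxx ?mulr1//.
  by rewrite (negPf ik) mulr0.
have da : is_derive (0 : R) 1 (fun t : R => t * x 0 k + (x *m w) 0 0) (x 0 k).
  by apply: is_derive_eq; rewrite scaler0 add0r addr0 /GRing.scale/= mulr1.
have [da1 da2] := da.
rewrite (derive1_comp da1 (dh _)) mul0r add0r.
by rewrite [X in _ * X = _]derive1E da2.
Qed.

(** This is the limit of the hypothesis as [a] tends to 0. *)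
Lemma le_scaled (R : realType) (X Y Z : R) :
  (forall a, 0 < a <= 1 -> X <= Y + a * Z) -> X <= Y.
Proof.
move=> H; rewrite leNgt; apply/negP => YX.
(* For this [a] the term [a * Z] stays below half of the supposed positive difference [X - Y]. *)
have := H (Num.min 1 ((X - Y) / (2 * (1 + `|Z|)))).
set a := Num.min _ _ => Ha.
have Zp : 0 < 2 * (1 + `|Z|) by rewrite mulr_gt0// ltr_pwDl.
have a0 : 0 < a by rewrite lt_min ltr01 divr_gt0// subr_gt0.
have a1 : a <= 1 by rewrite ge_min lexx.
have a2 : a * (2 * (1 + `|Z|)) <= X - Y.
  by rewrite -ler_pdivlMr// ge_min lexx orbT.
have := Ha; rewrite a0 a1 => /(_ isT).
have : a * Z <= a * `|Z| by rewrite ler_pM2l// ler_norm.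
have : 0 <= a * `|Z| by rewrite mulr_ge0// ltW.
lra.
Qed.

(** After n steps the drift from [v0] is O(g), so by the Lipschitz bound the correction
    [h i v - h i v0] is O(g) and, multiplied by [g], contributes O(g^2) to the next step. The
    constant depends only on [K], [M] and the number of steps, hence is uniform in the maps [h] and
    in the sampled indices. *)
Lemma foldl_perturbed_step (R : realType) (V : normedModType R) (K M : R)
    (n : nat) : 0 <= K -> 0 <= M ->
  exists2 C : R, 0 <= C & forall (I : Type) (s : seq I) (h : I -> V -> V)
    (g : R) (mu v0 : V), size s = n -> 0 <= g <= 1 -> `|mu| <= M ->
    (forall i v v', `|h i v - h i v'| <= K * `|v - v'|) ->
    let v := foldl (fun v i => v - g *: (h i v - h i v0 + mu)) v0 s in
    `|v - v0| <= C * g /\ `|v - v0 + (n%:R * g) *: mu| <= C * g ^+ 2.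
Proof.
move=> K0 M0; elim: n => [|n [C C0 IH]].
  exists 0 => // I s h g mu v0 /size0nil -> _ _ _ /=.
  by rewrite subrr mul0r scale0r addr0 normr0 !mul0r.
(* The new step adds K C g^2 from the correction, and M g from [mu] to the drift; g <= 1 absorbs g^2
   into g. *)
exists (C + K * C + M) => [|I s h g mu v0]; first by rewrite !addr_ge0// mulr_ge0.
case/lastP: s => [//|s i]; rewrite size_rcons => -[sn] /andP[g0 g1] muM hK.
rewrite foldl_rcons.
have := IH I s h g mu v0 sn; rewrite g0 g1 => /(_ isT muM hK) /=.
set v := foldl _ _ _ => -[IH1 IH2].
have hv : `|h i v - h i v0| <= K * C * g.
  by rewrite (le_trans (hK _ _ _))// -mulrA ler_wpM2l.
have gh : `|g *: (h i v - h i v0)| <= K * C * g ^+ 2.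
  by rewrite normrZ ger0_norm// expr2 mulrA mulrC ler_wpM2r.
have gg : g ^+ 2 <= g by rewrite expr2 ler_piMl.
have KC : 0 <= K * C by rewrite mulr_ge0.
have step : v - g *: (h i v - h i v0 + mu) - v0 =
    (v - v0) - g *: (h i v - h i v0) - g *: mu.
  by rewrite scalerDr opprD addrAC addrA.
rewrite step; split.
  have gm : `|g *: mu| <= M * g by rewrite normrZ ger0_norm// mulrC ler_wpM2r.
  have := ler_normB (v - v0 - g *: (h i v - h i v0)) (g *: mu).
  have := ler_normB (v - v0) (g *: (h i v - h i v0)).
  by have := ler_wpM2l KC gg; rewrite !mulrDl; lra.
have -> : v - v0 - g *: (h i v - h i v0) - g *: mu + (n.+1%:R * g) *: mu =
          (v - v0 + (n%:R * g) *: mu) - g *: (h i v - h i v0).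
  rewrite -natr1 mulrDl mul1r scalerDl.
  by rewrite [_ *: mu + _]addrC addrA subrK addrAC.
have := ler_normB (v - v0 + (n%:R * g) *: mu) (g *: (h i v - h i v0)).
have := mulr_ge0 M0 (sqr_ge0 g); rewrite !mulrDl; lra.
Qed.

Section Descent.
Context (R : realType) (N d : nat) (x : 'I_N -> 'rV[R]_d) (f : 'I_N -> R -> R).
Context (hf : forall (i : 'I_N) (u : R), derivable (f i) u 1).
Context (L : R) (L0 : 0 <= L).
Context (hlip : forall (i : 'I_N) (w w' : 'cV[R]_d),
  enorm (grad (lin_comp (x i) (f i)) w - grad (lin_comp (x i) (f i)) w')
    <= L * enorm (w - w')).

(** The gradient bound is tested at multiples of the transposed row [x i], scaled so that their
    products with [x i] are [u] and [u']. Keeping the factor |x_i|^2 on the left covers a zero row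
    as well. *)
Lemma lipschitz_derive1 (i : 'I_N) (u u' : R) :
  `|derive1 (f i) u - derive1 (f i) u'| * \sum_k x i 0 k ^+ 2 <= L * `|u - u'|.
Proof.
set n2 := \sum_k _; have n20 : 0 <= n2 by rewrite sumr_ge0// => k _; exact: sqr_ge0.
have [->|n2n0] := eqVneq n2 0; first by rewrite mulr0 mulr_ge0.
have n2p : 0 < n2 by rewrite lt0r n2n0.
have xx (a : R) : (x i *m ((a / n2) *: (x i)^T)) 0 0 = a.
  rewrite -scalemxAr !mxE (_ : \sum_j _ = n2) ?divfK//.
  by apply: eq_bigr => k _; rewrite mxE expr2.
have := hlip i ((u / n2) *: (x i)^T) ((u' / n2) *: (x i)^T).
rewrite !grad_lin_comp// !xx -scalerBl enormZ -mulrBl normrM normfV (ger0_norm n20).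
set D := derive1 (f i) u - derive1 (f i) u'.
have -> : (\col_k ((f i)^`()%classic u * x i 0 k) -
           \col_k ((f i)^`()%classic u' * x i 0 k)) = D *: (x i)^T.
  by apply/colP => k; rewrite !mxE mulrBl.
have nx : enorm (x i)^T = Num.sqrt n2.
  by rewrite /enorm; congr (Num.sqrt _); apply: eq_bigr => k _; rewrite mxE.
rewrite enormZ nx => H.
have sp : 0 < Num.sqrt n2 by rewrite sqrtr_gt0.
rewrite -[X in _ * X](sqr_sqrtr n20) expr2 mulrA.
apply: (le_trans (ler_wpM2r (ltW sp) H)).
rewrite -!mulrA -expr2 sqr_sqrtr// [n2^-1 * _]mulVf// mulr1//.
Qed.

(* The mean value theorem suffices for the constant [L] (instead of [L / 2]). *)
Lemma lin_comp_taylor (i : 'I_N) (w v : 'cV[R]_d) :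
  `|lin_comp (x i) (f i) (w + v) - lin_comp (x i) (f i) w
     - \sum_k grad (lin_comp (x i) (f i)) w k 0 * v k 0|
    <= L * enorm v ^+ 2.
Proof.
rewrite grad_lin_comp// /lin_comp mulmxDr mxE.
set u := (x i *m w) 0 0; set e := (x i *m v) 0 0.
have eE : e = \sum_k x i 0 k * v k 0 by rewrite /e mxE.
have -> : \sum_k (\col_k0 ((f i)^`()%classic u * x i 0 k0)) k 0 * v k 0 =
    derive1 (f i) u * e.
  by rewrite eE mulr_sumr; apply: eq_bigr => k _; rewrite mxE mulrA.
have V0 : 0 <= enorm v ^+ 2 by exact: sqr_ge0.
have [->|e0] := eqVneq e 0.
  by rewrite addr0 subrr mulr0 subr0 normr0 mulr_ge0.
(* Mean value theorem between [u] and [u + e], with the endpoints ordered according to the sign of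
   [e]. *)
have [c cu ->] : exists2 c, `|c - u| <= `|e| &
    f i (u + e) - f i u = derive1 (f i) c * e.
  have isd (z : R) : is_derive z (1 : R) (f i) (derive1 (f i) z).
    by rewrite derive1E; apply/derivableP; exact: hf.
  have cont (a b : R) : {within `[a, b], continuous (f i)}.
    apply: continuous_subspaceT => z; apply: differentiable_continuous.
    by apply/derivable1_diffP; exact: hf.
  have [ep|en] := ltP 0 e.
    have [|c] := @MVT R (f i) (derive1 (f i)) u (u + e) _
      (fun z _ => isd z) (cont _ _).
      by rewrite ltrDl.
    rewrite in_itv/= => /andP[c1 c2] ->; exists c.
      by rewrite !ger0_norm ?subr_ge0 ?ltW// ltrBlDl.
    by rewrite [u + e]addrC addrK.
  have en' : e < 0 by rewrite lt_neqAle e0.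
  have [|c] := @MVT R (f i) (derive1 (f i)) (u + e) u _
    (fun z _ => isd z) (cont _ _).
    by rewrite gtrDl.
  rewrite in_itv/= => /andP[c1 c2] E; exists c.
    by rewrite !ler0_norm ?subr_le0 ?ltW//; lra.
  by rewrite -opprB E opprD addrA subrr add0r mulrN opprK.
rewrite -mulrBl normrM.
set n2 := \sum_k x i 0 k ^+ 2.
have n2p : 0 < n2.
  rewrite lt0r sumr_ge0 ?andbT; last by move=> k _; exact: sqr_ge0.
  apply: contra_neq e0 => n20; rewrite eE big1// => k _.
  by rewrite (sum_sqr_eq0 k n20) mul0r.
(* Cauchy-Schwarz *)
have CS : e ^+ 2 <= n2 * enorm v ^+ 2.
  have : 0 <= \sum_k (n2 * v k 0 + (- e) * x i 0 k) ^+ 2.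
    by rewrite sumr_ge0// => k _; exact: sqr_ge0.
  rewrite sum_sqr_lin -enorm_sqr -/n2.
  under [X in _ * _ * X]eq_bigr do rewrite mulrC.
  rewrite -eE.
  have -> : n2 ^+ 2 * enorm v ^+ 2 + 2 * n2 * (- e) * e + (- e) ^+ 2 * n2 =
            n2 * (n2 * enorm v ^+ 2 - e ^+ 2) by ring.
  by rewrite pmulr_rge0// subr_ge0.
(* Multiplied by |x_i|^2 > 0, the remainder is at most L |c - u| |e| <= L e^2, and Cauchy-Schwarz
   closes the bound. *)
rewrite -(ler_pM2r n2p) mulrAC.
apply: (le_trans (ler_wpM2r (normr_ge0 e) (lipschitz_derive1 i c u))).
rewrite -!mulrA ler_wpM2l//.
apply: (le_trans (ler_wpM2r (normr_ge0 e) cu)).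
by rewrite -expr2 real_normK ?num_real// mulrA mulrC.
Qed.

(** This is the gradient of the objective, taken as the mean of the component gradients;
    [objective_taylor] shows that it gives the first-order term. *)
Definition mean_grad (w : 'cV[R]_d) : 'cV[R]_d :=
  N%:R^-1 *: \sum_(i < N) grad (lin_comp (x i) (f i)) w.

Lemma objective_taylor (w v : 'cV[R]_d) : (0 < N)%N ->
  `|objective x f (w + v) - objective x f w - \sum_k mean_grad w k 0 * v k 0|
    <= L * enorm v ^+ 2.
Proof.
move=> N0; have Np : 0 < (N%:R : R) by rewrite ltr0n.
have -> : objective x f (w + v) - objective x f w
          - \sum_k mean_grad w k 0 * v k 0 =
  N%:R^-1 * \sum_(i < N) (lin_comp (x i) (f i) (w + v) - lin_comp (x i) (f i) w
     - \sum_k grad (lin_comp (x i) (f i)) w k 0 * v k 0).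
  rewrite /objective /mean_grad !sumrB !mulrBr; congr (_ - _ - _).
  rewrite exchange_big mulr_sumr/=; apply: eq_bigr => k _.
  by rewrite mxE summxE -mulrA mulr_suml.
rewrite normrM ger0_norm ?invr_ge0// ler_pdivrMl//.
apply: (le_trans (ler_norm_sum _ _ _)).
apply: (le_trans (ler_sum _ (fun i _ => lin_comp_taylor i w v))).
by rewrite sumr_const card_ord mulr_natl.
Qed.

(** Strong convexity on the segment from [w] to [v], compared with the Taylor bound near [w], yields
    the first-order lower bound on F(v). Completing a square then eliminates v - w. *)
Lemma strongly_convex_PL (xi : R) (w v : 'cV[R]_d) : (0 < N)%N -> 0 < xi ->
  strongly_convex xi (objective x f) ->
  2 * xi * (objective x f w - objective x f v) <=
    enorm (mean_grad w) ^+ 2.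
Proof.
move=> N0 xi0 sc; set F := objective x f.
set S := \sum_k mean_grad w k 0 * (v - w) k 0.
have H : S <= F v - F w - xi / 2 * enorm (v - w) ^+ 2.
  apply: (le_scaled (Z := (xi / 2 + L) * enorm (v - w) ^+ 2)) => a /andP[a0 a1].
  have := sc v w a; rewrite a1 ltW// => /(_ isT).
  have -> : a *: v + (1 - a) *: w = w + a *: (v - w).
    by rewrite scalerBl scale1r scalerBr addrCA.
  have := objective_taylor w (a *: (v - w)) N0.
  rewrite enormZ exprMn real_normK ?num_real//.
  have -> : \sum_k mean_grad w k 0 * (a *: (v - w)) k 0 = a * S.
    by rewrite mulr_sumr; apply: eq_bigr => k _; rewrite [X in _ * X]mxE mulrCA.
  (* Dividing by [a] leaves an error a (xi/2 + L) |v - w|^2: L from the Taylor remainder, xi/2 from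
     the factor 1 - a. *)
  rewrite -/F ler_norml => /andP[h1 _] h2.
  rewrite -(ler_pM2l a0); move: h1 h2; set E := enorm _ ^+ 2.
  by set y := F (w + _); nra.
(* Expand |grad F(w) + xi (v - w)|^2 >= 0 and bound the cross term by [H]; the terms in xi^2
   cancel. *)
have : 0 <= \sum_k (1 * mean_grad w k 0 + xi * (v - w) k 0) ^+ 2.
  by rewrite sumr_ge0// => k _; exact: sqr_ge0.
rewrite sum_sqr_lin -/S -!enorm_sqr expr1n mul1r mulr1.
have xi2 : 0 < 2 * xi by rewrite mulr_gt0.
have := ler_wpM2l (ltW xi2) H.
lra.
Qed.

End Descent.

(** * One outer iteration *)

Lemma ler_mx_norm (R : realType) (m : nat) (v : 'cV[R]_m) (c : R) :
  0 <= c -> (forall k, `|v k 0| <= c) -> `|v| <= c.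
Proof.
move=> c0 vc; have -> : `|v| = mx_norm v by [].
rewrite mx_normrE; apply: bigmax_le => // -[k j] _ /=.
by rewrite (ord1 j); exact: vc.
Qed.

Lemma coord_le_mx_norm (R : realType) (m : nat) (v : 'cV[R]_m) (k : 'I_m) :
  `|v k 0| <= `|v|.
Proof.
have -> : `|v| = mx_norm v by [].
by rewrite mx_normrE; exact: (le_bigmax _ (fun ij => `|v ij.1 ij.2|) (k, 0)).
Qed.

Section OneStep.
Context (R : realType) (N d : nat) (x : 'I_N -> 'rV[R]_d) (f : 'I_N -> R -> R).
Context (hf : forall (i : 'I_N) (u : R), derivable (f i) u 1).
Context (L : R) (L0 : 0 <= L).
Context (hlip : forall (i : 'I_N) (w w' : 'cV[R]_d),
  enorm (grad (lin_comp (x i) (f i)) w - grad (lin_comp (x i) (f i)) w')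
    <= L * enorm (w - w')).

Lemma partial_lipschitz : exists2 K : R, 0 <= K & forall i k (u u' : R),
  `|derive1 (f i) u * x i 0 k - derive1 (f i) u' * x i 0 k| <= K * `|u - u'|.
Proof.
pose n2 i := \sum_k x i 0 k ^+ 2.
have n20 i : 0 <= n2 i by rewrite sumr_ge0// => k _; exact: sqr_ge0.
(* A zero row gives the constant 0, by the convention on inverses. Below, the sum over all pairs
   serves as an upper bound for the maximum. *)
pose F (ik : 'I_N * 'I_d) := `|x ik.1 0 ik.2| * (L / n2 ik.1).
have F0 ik : 0 <= F ik by rewrite mulr_ge0// divr_ge0.
exists (\sum_ik F ik) => [|i k u u']; first by rewrite sumr_ge0.
apply: (le_trans _ (ler_wpM2r (normr_ge0 _) (ler_term_sum (i, k) F0))).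
rewrite /F/= -mulrBl normrM mulrC -mulrA.
have [n2i|nz] := eqVneq (n2 i) 0.
  by rewrite (sum_sqr_eq0 k n2i) normr0 !mul0r.
rewrite ler_wpM2l// mulrAC ler_pdivlMr ?lt0r ?nz ?n20//.
exact: (lipschitz_derive1 hf L0 hlip).
Qed.

(** Compare with the derivative at 0 by the Lipschitz bound; the partial inner product is bounded
    uniformly in the feature set [S]. *)
Lemma partial_bound (W : R) : 0 <= W ->
  exists2 A : R, 0 <= A & forall i k (S : {set 'I_d}) (w : 'cV[R]_d),
    (forall l, `|w l 0| <= W) ->
    `|derive1 (f i) (\sum_(l in S) x i 0 l * w l 0) * x i 0 k| <= A.
Proof.
move=> W0; have [K K0 HK] := partial_lipschitz.
pose F (ik : 'I_N * 'I_d) := `|derive1 (f ik.1) 0 * x ik.1 0 ik.2|.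
pose X (ik : 'I_N * 'I_d) := `|x ik.1 0 ik.2|.
have X0 : 0 <= \sum_ik X ik by apply: sumr_ge0 => ik _; exact: normr_ge0.
exists (\sum_ik F ik + K * (\sum_(l < d) (\sum_ik X ik) * W)) => [|i k S w wW].
  apply: addr_ge0; first by apply: sumr_ge0 => ik _; exact: normr_ge0.
  by apply: mulr_ge0 => //; apply: sumr_ge0 => l _; exact: mulr_ge0.
set u := \sum_(l in S) _.
have uW : `|u| <= \sum_(l < d) (\sum_ik X ik) * W.
  apply: (le_trans (ler_norm_sum _ _ _)); rewrite big_mkcond/=.
  apply: ler_sum => l _; case: ifP => _.
    rewrite normrM ler_pM//.
    exact: (ler_term_sum (i, l) (fun ik => normr_ge0 (x ik.1 0 ik.2))).
  exact: mulr_ge0.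
have h1 := HK i k u 0; rewrite subr0 in h1.
have h2 : F (i, k) <= \sum_ik F ik by apply: ler_term_sum => ik; exact: normr_ge0.
have h3 := ler_wpM2l K0 uW.
have := ler_normD (derive1 (f i) 0 * x i 0 k)
  (derive1 (f i) u * x i 0 k - derive1 (f i) 0 * x i 0 k).
rewrite addrC subrK; rewrite /F/= in h2; lra.
Qed.

Lemma local_grad_lipschitz (P Q : nat) (sp : splitting N d P Q) :
  exists2 K : R, 0 <= K & forall q k i (v v' : 'cV[R]_(d %/ (Q * P))),
    `|grad (lin_comp (sub_row sp q k (x i)) (f i)) v
      - grad (lin_comp (sub_row sp q k (x i)) (f i)) v'| <= K * `|v - v'|.
Proof.
have [K K0 HK] := partial_lipschitz.
pose X (ik : 'I_N * 'I_d) := `|x ik.1 0 ik.2|.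
pose Y : R := \sum_(l < d %/ (Q * P)) \sum_ik X ik.
have Y0 : 0 <= Y.
  by apply: sumr_ge0 => l _; apply: sumr_ge0 => ik _; exact: normr_ge0.
exists (K * Y) => [|q k i v v']; first exact: mulr_ge0.
apply: ler_mx_norm => [|l]; first by rewrite !mulr_ge0.
rewrite !grad_lin_comp// !mxE; apply: (le_trans (HK _ _ _ _)).
rewrite -mulrA ler_wpM2l// -sumrB.
apply: (le_trans (ler_norm_sum _ _ _)); rewrite mulr_suml.
apply: ler_sum => l' _; rewrite -mulrBr normrM ler_pM//.
  rewrite mxE.
  exact: (ler_term_sum (i, coord sp (q, k, l'))
    (fun ik => normr_ge0 (x ik.1 0 ik.2))).
by have := coord_le_mx_norm (v - v') l'; rewrite !mxE.
Qed.

Lemma sodda_mu_bound (W : R) : 0 <= W ->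
  exists2 A : R, 0 <= A & forall (s : nat) (Bt Ct : {set 'I_d}) (Dt : {set 'I_N})
    (w : 'cV[R]_d), (1 <= s)%N -> (forall l, `|w l 0| <= W) ->
    forall k, `|sodda_mu x f s Bt Ct Dt w k 0| <= A.
Proof.
move=> W0; have [A A0 HA] := partial_bound W0.
exists (N%:R * A) => [|s Bt Ct Dt w s1 wW k]; first exact: mulr_ge0.
rewrite /sodda_mu mxE summxE normrM ger0_norm ?invr_ge0//.
(* The average is bounded crudely: its weight by 1 and the number of its terms by [N], whatever the
   size of [Dt]. *)
have s1' : (s%:R : R)^-1 <= 1 by rewrite invf_le1 ?ler1n ?ltr0n.
apply: (le_trans (ler_wpM2r (normr_ge0 _) s1')); rewrite mul1r.
apply: (le_trans (ler_norm_sum _ _ _)).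
rewrite big_mkcond/= mulr_natl -[X in _ *+ X]card_ord -sumr_const.
apply: ler_sum => i _; case: ifP => // _; rewrite mxE; case: ifP => _.
  exact: HA.
by rewrite normr0.
Qed.

Lemma mean_grad_bound (W : R) : 0 <= W ->
  exists2 A : R, 0 <= A & forall (w : 'cV[R]_d), (forall l, `|w l 0| <= W) ->
    forall k, `|mean_grad x f w k 0| <= A.
Proof.
move=> W0; have [A A0 HA] := partial_bound W0.
exists (N%:R * A) => [|w wW k]; first exact: mulr_ge0.
rewrite /mean_grad mxE summxE normrM ger0_norm ?invr_ge0//.
have s1' : (N%:R : R)^-1 <= 1.
  by case: (N) => [|n]; rewrite ?invr0// invf_le1 ?ler1n ?ltr0n.
apply: (le_trans (ler_wpM2r (normr_ge0 _) s1')); rewrite mul1r.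
apply: (le_trans (ler_norm_sum _ _ _)).
rewrite mulr_natl -[X in _ *+ X]card_ord -sumr_const.
apply: ler_sum => i _; rewrite grad_lin_comp// !mxE.
have := HA i k [set: 'I_d]%SET w wW.
by under eq_bigl do rewrite finset.in_setT.
Qed.

(** Each coordinate belongs to exactly one sub-block, whose inner loop is an instance of
    [foldl_perturbed_step] with [B] steps. The bound is therefore uniform in the permutations and in
    the sampled observations. *)
Lemma sodda_step_expansion (P Q B : nat) (sp : splitting N d P Q) (W : R) :
  0 <= W -> exists2 C : R, 0 <= C &
  forall (s : nat) (Bt Ct : {set 'I_d}) (Dt : {set 'I_N}) (w : 'cV[R]_d)
    (g : R) (pi_ : 'I_Q -> {perm 'I_P})
    (J : 'I_P -> 'I_Q -> 'I_B -> 'I_(N %/ P)),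
  (1 <= s)%N -> (forall l, `|w l 0| <= W) -> 0 <= g <= 1 ->
  let mu := sodda_mu x f s Bt Ct Dt w in
  let w' := sodda_step sp x f g mu w pi_ J in
  forall r, `|(w' - w) r 0| <= C * g /\
    `|(w' - w) r 0 + (B%:R * g) * mu r 0| <= C * g ^+ 2.
Proof.
move=> W0; have [A A0 HA] := sodda_mu_bound W0.
have [K K0 HK] := local_grad_lipschitz sp.
have [C C0 HC] := @foldl_perturbed_step R 'cV[R]_(d %/ (Q * P)) K A B K0 A0.
exists C => // s Bt Ct Dt w g pi_ J s1 wW g01 mu w' r.
have muA := HA s Bt Ct Dt w s1 wW.
rewrite !mxE; case E : (addr sp r) => [[q k] l].
set p := ((pi_ q)^-1)%g k.
have rE : coord sp (q, k, l) = r by rewrite -E Defs.addrK.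
pose h (i : 'I_B) := grad (lin_comp (sub_row sp q k (x (obs sp (p, J p q i))))
  (f (obs sp (p, J p q i)))).
have := HC 'I_B (enum 'I_B) h g (sub_col sp q k mu) (sub_col sp q k w)
  (size_enum_ord B) g01.
have smu : `|sub_col sp q k mu| <= A.
  by apply: ler_mx_norm => // l'; rewrite mxE; exact: muA.
move=> /(_ smu (fun i => HK q k _))[h1 h2].
rewrite -/(inner_loop sp x f g mu w p q k (J p q)) in h1 h2.
have e1 := coord_le_mx_norm (inner_loop sp x f g mu w p q k (J p q)
  - sub_col sp q k w) l.
have e2 := coord_le_mx_norm (inner_loop sp x f g mu w p q k (J p q)
  - sub_col sp q k w + (B%:R * g) *: sub_col sp q k mu) l.
rewrite !mxE rE in e1 e2.
by split; [exact: (le_trans e1 h1)|exact: (le_trans e2 h2)].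
Qed.

Lemma sodda_step_descent (P Q B : nat) (sp : splitting N d P Q) (W : R) :
  (0 < N)%N -> 0 <= W -> exists2 C : R, 0 <= C &
  forall (s : nat) (Bt Ct : {set 'I_d}) (Dt : {set 'I_N}) (w : 'cV[R]_d)
    (g : R) (pi_ : 'I_Q -> {perm 'I_P})
    (J : 'I_P -> 'I_Q -> 'I_B -> 'I_(N %/ P)),
  (1 <= s)%N -> (forall l, `|w l 0| <= W) -> 0 <= g <= 1 ->
  let mu := sodda_mu x f s Bt Ct Dt w in
  objective x f (sodda_step sp x f g mu w pi_ J) <=
    objective x f w - B%:R * g * \sum_k mean_grad x f w k 0 * mu k 0
    + C * g ^+ 2.
Proof.
move=> N0 W0; have [C C0 HC] := @sodda_step_expansion P Q B sp W W0.
have [A A0 HA] := mean_grad_bound W0.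
(* The first summand bounds the Taylor remainder; the second pairs the bounded gradient with the
   O(g^2) deviation from the single step -B g mu. *)
exists (L * (d%:R * C ^+ 2) + d%:R * (A * C)) => [|s Bt Ct Dt w g pi_ J s1 wW g01].
  by rewrite addr_ge0// !mulr_ge0// sqr_ge0.
rewrite /=; set mu := sodda_mu _ _ _ _ _ _ _.
set w' := sodda_step _ _ _ _ _ _ _ _.
have step r : `|(w' - w) r 0| <= C * g /\
    `|(w' - w) r 0 + (B%:R * g) * mu r 0| <= C * g ^+ 2.
  exact: HC.
have := objective_taylor hf L0 hlip w (w' - w) N0.
rewrite [w + _]addrC subrK => /(le_trans (ler_norm _)) h1.
have h2 : enorm (w' - w) ^+ 2 <= d%:R * C ^+ 2 * g ^+ 2.
  rewrite enorm_sqr -mulrA mulr_natl -[X in _ *+ X]card_ord -sumr_const.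
  apply: ler_sum => r _; rewrite -exprMn -real_normK ?num_real//.
  rewrite ler_sqr ?nnegrE//; first exact: (step r).1.
  by rewrite mulr_ge0//; case/andP: g01.
have h3 : \sum_k mean_grad x f w k 0 * (w' - w) k 0
    + B%:R * g * \sum_k mean_grad x f w k 0 * mu k 0 <= d%:R * (A * C) * g ^+ 2.
  have -> : d%:R * (A * C) * g ^+ 2 = \sum_(r < d) A * (C * g ^+ 2).
    by rewrite sumr_const card_ord -[RHS]mulr_natl !mulrA.
  rewrite mulr_sumr -big_split/=.
  apply: ler_sum => r _; rewrite mulrCA -mulrDr.
  apply: (le_trans (ler_norm _)); rewrite normrM ler_pM//; first exact: HA.
  exact: (step r).2.
have h4 := ler_wpM2l L0 h2.
by rewrite mulrDl; lra.
Qed.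

End OneStep.

(** * Rate of convergence *)

(** Induction with y = t + 1: if a_t <= M/y and K <= M (lambda - 1), then a_{t+1} <= M (y - 1)/y^2
    <= M/(y + 1). *)
Lemma recursion_rate (R : realType) (lambda K : R) (a : nat -> R) (t0 : nat) :
  1 < lambda -> 0 <= K ->
  (forall t, (t0 <= t)%N ->
    a t.+1 <= (1 - lambda * t.+1%:R^-1) * a t + K * t.+1%:R^-1 ^+ 2) ->
  exists2 M, 0 < M & forall t, a t <= M * (1 + t%:R)^-1.
Proof.
move=> l1 K0 rec; have l0 : 0 < lambda - 1 by rewrite subr_gt0.
(* From [t1] on, lambda <= t + 1, so the contraction factor is nonnegative and the induction
   hypothesis may be multiplied by it. [S] takes care of the earlier indices. *)
pose t1 := maxn t0 (Num.truncn lambda).+1.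
pose S := \sum_(i < t1.+1) (1 + i%:R) * `|a i|.
have S0 : 0 <= S by rewrite sumr_ge0// => i _; rewrite mulr_ge0.
have KM : 0 <= K / (lambda - 1) by rewrite divr_ge0// ltW.
exists (K / (lambda - 1) + S + 1) => [|t]; first by rewrite ltr_pwDr// addr_ge0.
set M := _ + S + 1; have MK : K <= M * (lambda - 1).
  by rewrite -ler_pdivrMr// /M; lra.
have M0 : 0 <= M by rewrite /M !addr_ge0.
have p0 (n : nat) : 0 < 1 + n%:R :> R by rewrite ltr_pwDl.
have small i : (i <= t1)%N -> a i <= M * (1 + i%:R)^-1.
  move=> it1; rewrite ler_pdivlMr//.
  apply: (@le_trans _ _ S); last by rewrite /M; lra.
  have := ler_term_sum (Ordinal (it1 : (i < t1.+1)%N))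
    (fun i : 'I_t1.+1 => mulr_ge0 (ltW (p0 i)) (normr_ge0 (a i))).
  apply: le_trans; rewrite /= mulrC.
  by apply: ler_wpM2l; [exact: ltW|exact: ler_norm].
have [/small//|t1t] := leqP t t1.
elim: t t1t => // t IH; rewrite ltnS leq_eqVlt => /orP t1t.
have {}IH : a t <= M * (1 + t%:R)^-1.
  by case: t1t => [/eqP E|/IH//]; apply: small; rewrite E.
have {}t1t : (t1 <= t)%N by case: t1t => [/eqP->|/ltnW].
have lt : lambda <= t.+1%:R.
  apply/ltW/(lt_le_trans (truncnS_gt lambda)); rewrite ler_nat.
  by rewrite (leq_trans _ (leqW t1t))// leq_maxr.
have := rec t (leq_trans (leq_maxl _ _) t1t).
rewrite -natr1 [_ + 1]addrC in lt *; set y := 1 + t%:R in IH lt *.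
have y0 : 0 < y by exact: p0.
move=> /le_trans; apply.
have c0 : 0 <= 1 - lambda * y^-1 by rewrite subr_ge0 ler_pdivrMr// mul1r.
have h1 := ler_wpM2l c0 IH.
apply: (le_trans (lerD h1 (lexx _))).
have -> : (1 - lambda * y^-1) * (M * y^-1) + K * y^-1 ^+ 2 =
          ((y - lambda) * M + K) / y ^+ 2 by field; rewrite gt_eqF.
rewrite ler_pdivrMr ?exprn_gt0// mulrAC ler_pdivlMr; last first.
  by rewrite ltr_pwDl// ltW.
have h2 : (y - lambda) * M + K <= (y - 1) * M by lra.
have y1 : 0 <= 1 + y by rewrite addr_ge0// ltW.
have := ler_wpM2r y1 h2; lra.
Qed.

(** * Laws of the draws and mean of the gradient estimate *)

Section Draws.
Context (dsp : measure_display) (T : measurableType dsp) (R : realType).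
Context (Pr : probability T R) (N d P Q B : nat) (b c s : nat -> nat).
Context (smp : sampling T N d P Q B) (hsmp : sodda_sampling Pr b c s smp).

Lemma sum_pmf_drawD (t : nat) (j : 'I_N) : (1 <= s t <= N)%N ->
  \sum_(D : {set 'I_N} | j \in D) pmf Pr (drawD smp t) D = (s t)%:R / N%:R.
Proof.
move=> /andP[s1 sN].
have E : (s t).-1.+1 = s t by rewrite prednK.
have := @uniform_draw_mem R 'I_N (s t).-1 j; rewrite E card_ord => /(_ sN) /= <-.
by apply: eq_bigr => D _; rewrite /pmf (drawD_law hsmp t).
Qed.

Lemma card_full (S : {set 'I_d}) : (#|S| == d) = (S == [set: 'I_d]%SET).
Proof.
rewrite finset.eqEcard finset.subsetT cardsT card_ord eqn_leq.
by rewrite -[X in (_ <= X)%N]card_ord max_card.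
Qed.

(** When b_t = d the full set is the only possible feature set and has probability 1, so the
    conditional law of [drawC] is its law: uniform on the sets of size c_t. *)
Lemma pmf_drawBC (t : nat) (S U : {set 'I_d}) : b t = d ->
  pmf Pr (fun z => (drawB smp t z, drawC smp t z)) (S, U) =
  if S == [set: 'I_d]%SET then
    let A := [set V : {set 'I_d} | #|V| == c t]%SET in
    if U \in A then #|A|%:R^-1 else 0
  else 0.
Proof.
move=> btd; rewrite /pmf.
have -> : (fun z => (drawB smp t z, drawC smp t z)) @^-1` [set (S, U)] =
          [set z | drawB smp t z = S /\ drawC smp t z = U].
  by apply/seteqP; split=> z /= => [[-> ->]|[-> ->]].
rewrite (drawC_law hsmp) (drawB_law hsmp) /= [S \in _]inE btd card_full.
have [->|_] := eqVneq S [set: 'I_d]%SET; last by rewrite mul0r.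
rewrite card_draws card_ord binn invr1 mul1r.
have -> : [set V : {set 'I_d} | (V \subset [set: 'I_d]%SET) && (#|V| == c t)]%SET =
          [set V : {set 'I_d} | #|V| == c t]%SET.
  by apply/setP => V; rewrite !inE finset.subsetT.
by [].
Qed.

Lemma sum_pmf_drawC (t : nat) (k : 'I_d) : b t = d -> (1 <= c t <= d)%N ->
  \sum_(bc : {set 'I_d} * {set 'I_d} | k \in bc.2)
    pmf Pr (fun z => (drawB smp t z, drawC smp t z)) bc = (c t)%:R / d%:R.
Proof.
move=> btd /andP[c1 cd].
have E : (c t).-1.+1 = c t by rewrite prednK.
have := @uniform_draw_mem R 'I_d (c t).-1 k; rewrite E card_ord => /(_ cd) /= <-.
transitivity (\sum_(S : {set 'I_d}) \sum_(U : {set 'I_d} | k \in U)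
    pmf Pr (fun z => (drawB smp t z, drawC smp t z)) (S, U)).
  by rewrite pair_big_dep/=; apply: eq_bigr => -[].
rewrite (bigD1 [set: 'I_d]%SET)//= [X in _ + X]big1 ?addr0 => [|S ST].
  by apply: eq_bigr => U _; rewrite pmf_drawBC// eqxx.
by rewrite big1// => U _; rewrite pmf_drawBC// (negPf ST).
Qed.

Lemma drawB_full (t : nat) : b t = d ->
  {ae Pr, forall z, drawB smp t z = [set: 'I_d]%SET}.
Proof.
move=> btd; pose E := drawB smp t @^-1` [set [set: 'I_d]%SET].
have mE : measurable E.
  apply: (draw_measurable hsmp (a := LabelBC _ _ _ t)).
  exact: (@events_of_preimage _ _ (fun z => (drawB smp t z, drawC smp t z))
    [set u | u.1 = [set: 'I_d]%SET]).
exists (~` E); split; [exact: measurableC| |by []].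
rewrite probability_setC// (drawB_law hsmp) inE btd card_full eqxx.
by rewrite card_draws card_ord binn invr1 subee.
Qed.

End Draws.

(** A coordinate of the estimate is a sum over [j] of terms carrying the indicators of k in C and j
    in D. Only the inclusion probabilities enter, and 1/s times s/N gives the weight 1/N of the mean
    gradient. *)
Lemma mean_sodda_mu (R : realType) (N d : nat) (x : 'I_N -> 'rV[R]_d)
    (f : 'I_N -> R -> R) (pC : {set 'I_d} * {set 'I_d} -> R)
    (pD : {set 'I_N} -> R) (s : nat) (alpha : R) (w : 'cV[R]_d) (k : 'I_d) :
  (forall i u, derivable (f i) u 1) -> (0 < s)%N ->
  \sum_(bc : {set 'I_d} * {set 'I_d} | k \in bc.2) pC bc = alpha ->
  (forall j, \sum_(D : {set 'I_N} | j \in D) pD D = s%:R / N%:R) ->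
  \sum_bc \sum_D sodda_mu x f s [set: 'I_d]%SET bc.2 D w k 0 * (pC bc * pD D) =
  alpha * mean_grad x f w k 0.
Proof.
move=> hf s0 hC hD.
pose g j := derive1 (f j) ((x j *m w) 0 0) * x j 0 k.
have muE bc D : sodda_mu x f s [set: 'I_d]%SET bc D w k 0 =
    \sum_j s%:R^-1 * (g j * (k \in bc)%:R * (j \in D)%:R).
  rewrite /sodda_mu mxE summxE mulr_sumr big_mkcond/=; apply: eq_bigr => j _.
  case: ifP => _; last by rewrite !mulr0.
  rewrite mxE mulr1; case: ifP => _; last by rewrite !mulr0.
  rewrite mulr1 /g mxE.
  by under eq_bigl do rewrite finset.in_setT.
have s0' : (s%:R : R) != 0 by rewrite pnatr_eq0 -lt0n.
transitivity (\sum_j s%:R^-1 * g j *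
    (\sum_(bc : {set 'I_d} * {set 'I_d} | k \in bc.2) pC bc) *
    (\sum_(D : {set 'I_N} | j \in D) pD D)).
  transitivity (\sum_(bc : {set 'I_d} * {set 'I_d}) \sum_(D : {set 'I_N}) \sum_j
      s%:R^-1 * g j *
      ((if k \in bc.2 then pC bc else 0) * (if j \in D then pD D else 0))).
    apply: eq_bigr => bc _; apply: eq_bigr => D _; rewrite muE mulr_suml.
    apply: eq_bigr => j _.
    by case: (k \in bc.2); case: (j \in D) => /=; ring.
  under eq_bigr do rewrite exchange_big/=.
  rewrite exchange_big/=; apply: eq_bigr => j _.
  rewrite ![\sum_(_ | _ \in _) _]big_mkcond/=.
  rewrite -mulrA mulr_suml mulr_sumr; apply: eq_bigr => bc _.
  by rewrite -!mulr_sumr.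
rewrite /mean_grad mxE summxE hC mulrCA mulr_sumr mulr_sumr.
apply: eq_bigr => j _; rewrite hD grad_lin_comp// mxE -/(g j).
by field; rewrite s0' andbT pnatr_eq0 -lt0n (leq_ltn_trans _ (ltn_ord j)).
Qed.

(** * Recursion for the expected gap *)

Section ExpectedDescent.
Context (dsp : measure_display) (T : measurableType dsp) (R : realType).
Context (Pr : probability T R) (N d P Q B : nat) (b c s : nat -> nat).
Context (smp : sampling T N d P Q B) (hsmp : sodda_sampling Pr b c s smp).
Context (N0 : (0 < N)%N) (d0 : (0 < d)%N).
Context (hc : forall t, (1 <= c t <= d)%N) (hs : forall t, (1 <= s t <= N)%N).
Context (x : 'I_N -> 'rV[R]_d) (f : 'I_N -> R -> R).
Context (hf : forall (i : 'I_N) (u : R), derivable (f i) u 1).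
Context (L : R) (L0 : 0 <= L).
Context (hlip : forall (i : 'I_N) (w w' : 'cV[R]_d),
  enorm (grad (lin_comp (x i) (f i)) w - grad (lin_comp (x i) (f i)) w')
    <= L * enorm (w - w')).
Context (xi : R) (xi0 : 0 < xi) (hconvex : strongly_convex xi (objective x f)).
Context (sp : splitting N d P Q) (gamma : nat -> R) (W : R).
Context (hW : forall t : nat,
  {ae Pr, forall z : T, enorm (sodda sp x f gamma s smp t z) <= W}).
Context (wstar : 'cV[R]_d).

Let F := objective x f.
Let gap (t : nat) (z : T) : R := F (sodda sp x f gamma s smp t z) - F wstar.

Lemma gap_history (t : nat) : exists g, gap t = g \o history smp t.
Proof.
apply: (fun_history 0) => z z' H; congr (F _ - _).
exact: sodda_history.
Qed.

Lemma expectation_gap (t : nat) : 'E_Pr[gap t]%E = (fine 'E_Pr[gap t]%E)%:E.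
Proof.
have [g ->] := gap_history t.
by rewrite expectation_pmf//; exact: (measurable_history hsmp).
Qed.

(** The descent estimate holds along almost every run; almost surely [drawB] is the full set, which
    replaces it here so that the estimate can be averaged over [drawC] and [drawD]. *)
Lemma gap_descent : exists2 C : R, 0 <= C & forall t, b t = d ->
  0 <= gamma t.+1 <= 1 ->
  {ae Pr, forall z, gap t.+1 z <= gap t z
    - B%:R * gamma t.+1 *
      (\sum_k mean_grad x f (sodda sp x f gamma s smp t z) k 0 *
        sodda_mu x f (s t) [set: 'I_d]%SET (drawC smp t z) (drawD smp t z)
          (sodda sp x f gamma s smp t z) k 0)
    + C * gamma t.+1 ^+ 2}.
Proof.
(* The absolute value of [W] supplies a nonnegative bound on the coordinates. *)
have [C C0 HC] := @sodda_step_descent R N d x f hf L L0 hlip P Q B sp `|W| N0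
  (normr_ge0 W).
exists C => // t btd g01.
apply: filterS2 (drawB_full hsmp btd) (hW t) => z Bz Wz.
have wW l : `|sodda sp x f gamma s smp t z l 0| <= `|W|.
  by rewrite (le_trans (coord_le_enorm _ _))// (le_trans Wz)// ler_norm.
have [s1 _] := andP (hs t).
have := HC (s t) (drawB smp t z) (drawC smp t z) (drawD smp t z)
  (sodda sp x f gamma s smp t z) (gamma t.+1) (fun q => drawPi smp t q z)
  (fun p q i => drawJ smp t p q i z) s1 wW g01.
rewrite /= -/(F _) -/(F (sodda sp x f gamma s smp t z)).
have -> : sodda_step sp x f (gamma t.+1)
   (sodda_mu x f (s t) (drawB smp t z) (drawC smp t z) (drawD smp t z)
      (sodda sp x f gamma s smp t z)) (sodda sp x f gamma s smp t z)
   (drawPi smp t ^~ z) (fun p q i => drawJ smp t p q i z) =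
   sodda sp x f gamma s smp t.+1 z by [].
rewrite Bz /gap; set w' := sodda _ _ _ _ _ _ t.+1 z; set w := sodda _ _ _ _ _ _ t z.
clearbody w w'; lra.
Qed.

(** With the history frozen, averaging over the independent draws turns the inner product into
    (c_t/d) |grad F|^2. The Polyak-Lojasiewicz inequality and c_t >= 1 bound this below by (2 xi/d)
    times the gap. *)
Lemma expected_gap_descent : exists2 C : R, 0 <= C & forall t, b t = d ->
  0 <= gamma t.+1 <= 1 ->
  fine 'E_Pr[gap t.+1]%E <=
    (1 - 2 * xi * B%:R / d%:R * gamma t.+1) * fine 'E_Pr[gap t]%E
    + C * gamma t.+1 ^+ 2.
Proof.
have [C C0 HC] := gap_descent.
exists C => // t btd g01; have g0 : 0 <= gamma t.+1 by case/andP: g01.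
have [w Hw] : exists w, sodda sp x f gamma s smp t = w \o history smp t.
  by apply: (fun_history 0) => z z'; exact: sodda_history.
have [g' Hg'] := gap_history t.+1.
have mX : measurable_fibers (history smp t) by exact: (measurable_history hsmp).
have mX' : measurable_fibers (history smp t.+1) by exact: (measurable_history hsmp).
have mBC : measurable_fibers (fun z => (drawB smp t z, drawC smp t z)).
  exact: (measurable_drawBC hsmp).
have mD : measurable_fibers (drawD smp t) by exact: (measurable_drawD hsmp).
pose X := history smp t.
pose BC z := (drawB smp t z, drawC smp t z).
pose D := drawD smp t.
have -> : gap t = (fun u => F (w u) - F wstar) \o X.
  by apply: funext => z; rewrite /gap Hw.
rewrite Hg' !expectation_pmf//.
rewrite ![fine _]/=.
pose m u (bc : {set 'I_d} * {set 'I_d}) (E : {set 'I_N}) k :=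
  sodda_mu x f (s t) [set: 'I_d]%SET bc.2 E (w u) k 0.
pose H (y : {ffun history_label P Q B t -> draw_value N d P} *
    ({set 'I_d} * {set 'I_d}) * {set 'I_N}) : R :=
  F (w y.1.1) - F wstar
  - B%:R * gamma t.+1 *
    (\sum_k mean_grad x f (w y.1.1) k 0 * m y.1.1 y.1.2 y.2 k)
  + C * gamma t.+1 ^+ 2.
have mZ : measurable_fibers (fun z => (X z, BC z, D z)).
  by do 2?apply: measurable_fibers_pair.
(* The left side runs over histories of length [t.+1], the right side over shorter histories
   together with the current sets. *)
have le1 : \sum_u g' u * pmf Pr (history smp t.+1) u <=
    \sum_y H y * pmf Pr (fun z => (X z, BC z, D z)) y.
  apply: ae_le_sum_pmf => //.
  apply: filterS (HC t btd g01) => z; rewrite Hg' /gap Hw.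
  by [].
apply: (le_trans le1).
set pX := pmf Pr X; set pBC := pmf Pr BC; set pD := pmf Pr D.
have sX : \sum_u pX u = 1 by exact: sum_pmf.
have sBC : \sum_u pBC u = 1 by exact: sum_pmf.
have sD : \sum_u pD u = 1 by exact: sum_pmf.
pose alpha : R := (c t)%:R / d%:R.
have mm u k : \sum_bc \sum_E m u bc E k * (pBC bc * pD E) =
    alpha * mean_grad x f (w u) k 0.
  apply: mean_sodda_mu => //; first by have /andP[] := hs t.
    exact: (sum_pmf_drawC hsmp).
  by move=> j; exact: (sum_pmf_drawD hsmp).
have -> : \sum_y H y * pmf Pr (fun z => (X z, BC z, D z)) y =
    \sum_u \sum_bc \sum_E pX u * (H (u, bc, E) * (pBC bc * pD E)).
  rewrite !pair_bigA; apply: eq_bigr => -[[u bc] E] _ /=.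
  by rewrite (pmf_history hsmp) -/pX -/pBC -/pD; ring.
(* Conditional expectation of the bound given the history [u]. *)
have HE u : \sum_bc \sum_E H (u, bc, E) * (pBC bc * pD E) =
    F (w u) - F wstar + C * gamma t.+1 ^+ 2
    - B%:R * gamma t.+1 * (alpha * enorm (mean_grad x f (w u)) ^+ 2).
  set a := F (w u) - F wstar + _; set e := B%:R * gamma t.+1.
  transitivity (\sum_bc \sum_E (a * (pBC bc * pD E)
      - e * \sum_k mean_grad x f (w u) k 0 * (m u bc E k * (pBC bc * pD E)))).
    apply: eq_bigr => bc _; apply: eq_bigr => E _.
    under [X in _ = _ - _ * X]eq_bigr do rewrite mulrA.
    by rewrite -mulr_suml /H /a /e /=; ring.
  under eq_bigr do rewrite sumrB.
  rewrite sumrB; congr (_ - _).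
    under eq_bigr do rewrite -mulr_sumr -mulr_sumr sD mulr1.
    by rewrite -mulr_sumr sBC mulr1.
  under eq_bigr do rewrite -mulr_sumr exchange_big/=.
  rewrite -mulr_sumr exchange_big/=; congr (_ * _).
  rewrite enorm_sqr mulr_sumr; apply: eq_bigr => k _.
  under eq_bigr do rewrite -mulr_sumr.
  by rewrite -mulr_sumr mm; ring.
have -> : \sum_u \sum_bc \sum_E pX u * (H (u, bc, E) * (pBC bc * pD E)) =
    \sum_u pX u * (F (w u) - F wstar + C * gamma t.+1 ^+ 2
      - B%:R * gamma t.+1 * (alpha * enorm (mean_grad x f (w u)) ^+ 2)).
  apply: eq_bigr => u _; rewrite -HE mulr_sumr; apply: eq_bigr => bc _.
  by rewrite mulr_sumr.
(* The masses of the histories sum to 1, so the constant is spread over them and the inequality is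
   proved history by history. *)
have e2 : C * gamma t.+1 ^+ 2 = \sum_u C * gamma t.+1 ^+ 2 * pX u.
  by rewrite -mulr_sumr sX mulr1.
rewrite [X in _ <= _ + X]e2 mulr_sumr -big_split/=.
apply: ler_sum => u _.
have dp : 0 < (d%:R : R) by rewrite ltr0n.
have alpha1 : d%:R^-1 <= alpha.
  rewrite /alpha -[leLHS]mul1r ler_pM2r ?invr_gt0// ler1n.
  by have /andP[] := hc t.
set G2 := enorm _ ^+ 2; have G20 : 0 <= G2 by exact: sqr_ge0.
have PL : 2 * xi * (F (w u) - F wstar) <= G2.
  exact: (strongly_convex_PL hf L0 hlip).
have Bg : 0 <= B%:R * gamma t.+1 by exact: mulr_ge0.
have h1 : d%:R^-1 * (2 * xi * (F (w u) - F wstar)) <= alpha * G2.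
  apply: (le_trans _ (ler_wpM2r G20 alpha1)).
  by rewrite ler_pM2l ?invr_gt0.
have h2 := ler_wpM2l (pmf_ge0 Pr X u) (ler_wpM2l Bg h1).
rewrite -/pX -/(pX u) in h2; lra.
Qed.

End ExpectedDescent.

(* A batch size is an integer, and the lower bound on it tends to [d]. *)
Lemma eventually_full_batch (R : realType) (d : nat) (b c : nat -> nat)
    (gamma : nat -> R) (M2 L eta : R) :
  (forall t, (1 <= c t)%N) -> (forall t, (b t <= d)%N) ->
  (forall t, (0 < t)%N -> gamma t = t%:R^-1) -> 0 <= eta ->
  (forall t, d%:R / (1 + 4 * d%:R * eta * gamma t.+1 ^+ 2
                     / ((c t)%:R * M2 ^+ 2 * L ^+ 2)) <= (b t)%:R) ->
  exists t0, forall t, (t0 <= t)%N -> b t = d.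
Proof.
move=> hc1 hbd hgamma heta hb.
pose K := 4 * d%:R * eta / (M2 ^+ 2 * L ^+ 2).
have K0 : 0 <= K.
  apply: divr_ge0; first by rewrite !mulr_ge0.
  by apply: mulr_ge0; exact: sqr_ge0.
(* For such [t], d K/(t+1) < 1. Since d <= b_t (1 + e) with e <= K/(t+1), this gives d < b_t + 1,
   and both are integers. *)
exists (Num.truncn (d%:R * K)) => t t0t.
apply/eqP; rewrite eqn_leq hbd -ltnS -(ltr_nat R).
have := hb t; rewrite hgamma//; set g := t.+1%:R^-1.
have g0 : 0 <= g by rewrite invr_ge0.
have g1 : g <= 1 by rewrite invf_le1 ?ler1n ?ltr0n.
have ci : (c t)%:R^-1 <= 1 :> R by rewrite invf_le1 ?ler1n ?ltr0n.
have -> : 4 * d%:R * eta * g ^+ 2 / ((c t)%:R * M2 ^+ 2 * L ^+ 2) =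
          K * g ^+ 2 * (c t)%:R^-1.
  by rewrite /K !invfM; ring.
set e := K * _ * _.
have Kg0 : 0 <= K * g ^+ 2 by rewrite mulr_ge0// sqr_ge0.
have e0 : 0 <= e by rewrite mulr_ge0.
have eKg : e <= K * g.
  apply: (@le_trans _ _ (K * g ^+ 2)); first by rewrite ler_piMr.
  by rewrite ler_wpM2l// expr2 ler_piMl.
have dKg : d%:R * K * g < 1.
  rewrite ltr_pdivrMr ?ltr0n// mul1r.
  by rewrite (lt_le_trans (truncnS_gt _))// ler_nat ltnS.
rewrite ler_pdivrMr ?ltr_pwDl// => H.
have bd : (b t)%:R <= d%:R :> R by rewrite ler_nat.
have h1 := ler_wpM2r e0 bd.
have h2 := ler_wpM2l (ler0n R d) eKg.
rewrite -natr1; lra.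
Qed.

Theorem theorem6
  (R : realType) (dsp : measure_display) (T : measurableType dsp)
  (Pr : probability T R)
  (N d P Q B : nat)
  (hN : (0 < N)%N) (hd : (0 < d)%N) (hP : (0 < P)%N) (hQ : (0 < Q)%N)
  (hPN : (P %| N)%N) (hQPd : (Q * P %| d)%N)
  (x : 'I_N -> 'rV[R]_d) (f : 'I_N -> R -> R)
  (hf : forall (i : 'I_N) (u : R), derivable (f i) u 1)
  (sp : splitting N d P Q)
  (wstar : 'cV[R]_d) (hwstar : unique_minimizer (objective x f) wstar)
  (hB : (1 <= B)%N)
  (gamma : nat -> R) (b c s : nat -> nat)
  (hc1 : forall t, (1 <= c t)%N) (hcb : forall t, (c t <= b t)%N)
  (hbd : forall t, (b t <= d)%N) (hs : forall t, (1 <= s t <= N)%N)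
  (smp : sampling T N d P Q B) (hsmp : sodda_sampling Pr b c s smp)
  (xi L G M2 eta : R)
  (hxi : 0 < xi) (hconvex : strongly_convex xi (objective x f))
  (hL : 1 <= L)
  (hlip : forall (i : 'I_N) (w w' : 'cV[R]_d),
     enorm (grad (lin_comp (x i) (f i)) w - grad (lin_comp (x i) (f i)) w')
       <= L * enorm (w - w'))
  (hG : forall t : nat, {ae Pr, forall z : T,
     (N%:R - 1)^-1 *
       \sum_(j < N)
         (enorm (grad (lin_comp (x j) (f j)) (sodda sp x f gamma s smp t z)) ^+ 2
          - enorm (grad (objective x f) (sodda sp x f gamma s smp t z)) ^+ 2)
       <= G ^+ 2})
  (hM2 : forall t : nat, {ae Pr, forall z : T,
     enorm (sodda sp x f gamma s smp t z) <= M2 / 2})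
  (hM2star : enorm wstar <= M2 / 2)
  (hgamma : forall t : nat, (0 < t)%N -> gamma t = t%:R^-1)
  (hBxi : d%:R / (2 * xi) <= B%:R)
  (heta : 0 <= eta)
  (hb : forall t : nat,
     Num.max (c t)%:R
       (d%:R / (1 + 4 * d%:R * eta * gamma t.+1 ^+ 2
                    / ((c t)%:R * M2 ^+ 2 * L ^+ 2)))
       <= (b t)%:R <= (d%:R : R)) :
  let F := objective x f in
  let gap (t : nat) : \bar R :=
    ('E_Pr[fun z : T => (F (sodda sp x f gamma s smp t z) - F wstar)%R])%E in
  let lambda := 2 * xi * B%:R / d%:R in
  exists C3 : R, 0 < C3 /\
    let Rconst : \bar R :=
      Order.max
        (\big[Order.max/(F 0 - F wstar)%:E]_(1 <= i < (Num.truncn lambda).+2)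
           (i.+1%:R%:E * gap i)%E)
        (rate_tail C3 lambda) in
    forall t : nat, (gap t <= Rconst * ((1 + t%:R)^-1)%:E)%E.
Proof.
move=> F gap lambda.
have dp : 0 < (d%:R : R) by rewrite ltr0n.
have l1 : 1 <= lambda.
  move: hBxi; rewrite ler_pdivrMr ?mulr_gt0// /lambda ler_pdivlMr// mul1r; lra.
have hc t : (1 <= c t <= d)%N by rewrite hc1 (leq_trans (hcb t)).
have gapE t : gap t = (fine (gap t))%:E.
  exact: (expectation_gap hsmp x f sp gamma wstar t).
have pos t : (0 < ((1 + t%:R)^-1)%:E :> \bar R)%E.
  by rewrite lte_fin invr_gt0 ltr_pwDl.
(* For lambda = 1 the tail is infinite and any positive constant works. *)
have [l1'|ln1] := eqVneq lambda 1.
  exists 1; split=> // Rconst t; rewrite /Rconst /rate_tail l1' eqxx maxey.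
  by rewrite gt0_mulye// leey.
have {}l1 : 1 < lambda by rewrite lt_neqAle eq_sym ln1.
have [t0 full] : exists t0, forall t, (t0 <= t)%N -> b t = d.
  apply: (eventually_full_batch (M2 := M2) (L := L) hc1 hbd hgamma heta) => t.
  by have /andP[+ _] := hb t; rewrite ge_max => /andP[_].
have [C C0 descent] := @expected_gap_descent _ _ _ _ _ _ _ _ _ _ _ _ _ hsmp
  hN hd hc hs x f hf L (le_trans ler01 hL) hlip xi hxi hconvex sp gamma _ hM2 wstar.
have [M M0 HM] : exists2 M, 0 < M & forall t, fine (gap t) <= M * (1 + t%:R)^-1.
  apply: (recursion_rate (t0 := t0) l1 C0) => t t0t.
  have := descent t (full t t0t); rewrite hgamma//; apply.
  by rewrite invr_ge0 ler0n invf_le1 ?ler1n ?ltr0n.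
have l0 : 0 < lambda - 1 by rewrite subr_gt0.
(* With this choice the tail C3/(lambda - 1) equals [M], so the maximum is at least [M]. *)
exists (M * (lambda - 1)); split=> [|Rconst t]; first exact: mulr_gt0.
have MR : (M%:E <= Rconst)%E.
  rewrite /Rconst /rate_tail (negPf ln1) mulfK ?gt_eqF//.
  by rewrite le_max lexx orbT.
apply: (le_trans _ (lee_wpmul2r (ltW (pos t)) MR)).
by rewrite gapE -EFinM lee_fin.
Qed.
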